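(* Let $n\ge 0$ and $l\geq n$ be integers and let $x_1,\dots,x_{n+1},t_1,\dots,t_{l+1}$ be real numbers with $$x_1<x_2<\cdots<x_{n+1}<t_{l+1}<\cdots<t_2<t_1 .$$ Let $A=(a_{i,j})_{1\le i\le l+1;\,1\le j\le n+1}$ be the Lagrange-Vandermonde matrix $$a_{i,j}=\prod_{\substack{k=1\\ k\neq j}}^{n+1}(t_i-x_k).$$ Then $A$ is strictly totally positive and it admits a factorization $$A=F_{l}F_{l-1}\cdots F_1\, D\, G_1\cdots G_{n-1}G_{n},$$ where: (i) for $1\le i\le l$, $F_i$ is the $(l+1)\times(l+1)$ lower bidiagonal matrix with unit diagonal whose subdiagonal entries are $(F_i)_{i+k,\,i+k-1}=m_{i+k,k}$ for $1\le k\le l+1-i$ (with $m_{i+k,k}:=0$ if $k>n+1$), all other off-diagonal entries being $0$; (ii) for $1\le i\le n$, $G_i^T$ is the $(n+1)\times(n+1)$ lower bidiagonal matrix with unit diagonal whose subdiagonal entries are $(G_i^T)_{i+k,\,i+k-1}=\widetilde m_{i+k,k}$ for $1\le k\le n+1-i$, all other off-diagonal entries being $0$; (iii) $D$ is the $(l+1)\times(n+1)$ diagonal matrix $D=\mathrm{diag}\{p_{1,1},p_{2,2},\ldots,p_{n+1,n+1}\}$. Moreover, the elements $m_{i,j}$ and $\widetilde m_{i,j}$ are the multipliers of the Neville elimination of $A$ and of $A^T$, respectively, the elements $p_{i,i}$ are the diagonal pivots of the Neville elimination of $A$, and they are given by $$m_{i,j}=(t_{i-j}-x_j)\,\frac{\prod_{k=i-j+1}^{i-1}(t_i-t_k)\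 \prod_{k=j+1}^{n+1}(t_i-x_k)}{\prod_{k=i-j}^{i-2}(t_{i-1}-t_k)\ \prod_{k=j}^{n+1}(t_{i-1}-x_k)},\qquad j=1,\ldots,n+1;\ i=j+1,\ldots,l+1,$$ $$\widetilde m_{i,j}=(t_j-x_{i-j})\,\frac{\prod_{k=i-j+1}^{i-1}(x_i-x_k)\ \prod_{k=1}^{j-1}(t_k-x_{i-1})}{\prod_{k=i-j}^{i-2}(x_{i-1}-x_k)\ \prod_{k=1}^{j}(t_k-x_i)},\qquad j=1,\dots,n;\ i=j+1,\ldots,n+1,$$ $$p_{i,i}=\frac{\prod_{k=1}^{i-1}(t_k-t_i)\ \prod_{k=1}^{i-1}(x_i-x_k)\ \prod_{k=i+1}^{n+1}(t_i-x_k)}{\prod_{k=1}^{i-1}(t_k-x_i)},\qquad i=1,\ldots,n+1.$$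
   Context: A real matrix is strictly totally positive (STP) if all its minors (of all orders) are positive. Empty products equal $1$. Neville elimination (without row exchanges) of an $r\times c$ matrix $B$: put $B^{(1)}=B$; for $j=1,2,\dots,\min(r,c)$ form $B^{(j+1)}$ from $B^{(j)}$ by making zeros in column $j$ below the diagonal, adding to each row a multiple of the previous row: for $i\le j$, row $i$ is unchanged, and for $i=j+1,\dots,r$, (row $i$ of $B^{(j+1)}$) $=$ (row $i$ of $B^{(j)}$) $-\,m_{i,j}\cdot$(row $i-1$ of $B^{(j)}$), where $m_{i,j}=b^{(j)}_{i,j}/b^{(j)}_{i-1,j}$. The numbers $p_{i,j}=b^{(j)}_{i,j}$ ($i\ge j$) are called the pivots, $p_{i,i}$ the diagonal pivots, and $m_{i,j}=p_{i,j}/p_{i-1,j}$ ($i>j$) the multipliers. This is well defined whenever all the pivots appearing in denominators are nonzero. *)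

(* Defs.v *)
From HB Require Import structures.
From mathcomp Require Import all_boot all_order all_algebra.
From mathcomp Require Import reals.

Set Implicit Arguments.
Unset Strict Implicit.
Unset Printing Implicit Defensive.

Import Order.TTheory GRing.Theory Num.Theory.
Local Open Scope ring_scope.

Definition strictly_totally_positive (R : numDomainType) (r c : nat)
    (B : 'M[R]_(r, c)) : Prop :=
  forall (k : nat) (f : 'I_k -> 'I_r) (g : 'I_k -> 'I_c),
    (forall a b : 'I_k, (a < b)%N -> (f a < f b)%N) ->
    (forall a b : 'I_k, (a < b)%N -> (g a < g b)%N) ->
    0 < \det (mxsub f g B).

(* The 1-based entry b_{i,j}; meaningful only for 1 <= i <= r.+1 and
   1 <= j <= c.+1. *)
Definition ent (R : Type) (r c : nat) (B : 'M[R]_(r.+1, c.+1)) (i j : nat) : R :=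
  B (inord i.-1) (inord j.-1).

Section Neville.
Variables (R : fieldType) (r c : nat).
Implicit Type B : 'M[R]_(r.+1, c.+1).

(* From B^(j) to B^(j+1). The ordinals i, k are 0-based, so they stand for
   row i.+1 and column k.+1, and the previous row has 1-based number i. *)
Definition neville_step (j : nat) B : 'M[R]_(r.+1, c.+1) :=
  \matrix_(i, k)
    if (i.+1 <= j)%N then B i k
    else B i k - ent B i.+1 j / ent B i j * ent B i k.+1.

Fixpoint neville_iter B (s : nat) : 'M[R]_(r.+1, c.+1) :=
  if s is s'.+1 then neville_step s (neville_iter B s') else B.

(* B^(j), for 1 <= j <= (minn r.+1 c.+1).+1; thus B^(1) = B. *)
Definition neville B (j : nat) : 'M[R]_(r.+1, c.+1) := neville_iter B j.-1.

Definition pivot B (i j : nat) : R := ent (neville B j) i j.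

Definition multiplier B (i j : nat) : R := pivot B i j / pivot B i.-1 j.

(* Since division by zero is total, it has to be said separately that no
   pivot occurring in a denominator vanishes. *)
Definition neville_well_defined B : Prop :=
  forall i j : nat, (1 <= j <= minn r.+1 c.+1)%N -> (j < i <= r.+1)%N ->
    pivot B i.-1 j != 0.

End Neville.

Section Factors.
Variable R : nzRingType.

(* The lower bidiagonal N x N matrix with unit diagonal whose subdiagonal
   entries are, in 1-based numbering, (i + k, i + k - 1) |-> m (i + k) k for
   1 <= k <= N - i, and 0 in the rows up to i. Below, the row number is
   a.+1 = i + k, hence k = a.+1 - i. *)
Definition bidiag_factor (N : nat) (m : nat -> nat -> R) (i : nat) : 'M[R]_N :=
  \matrix_(a, b)
    if a == b then 1
    else if ((a : nat) == b.+1) && (i < a.+1)%N then m a.+1 (a.+1 - i)%N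
    else 0.

Definition rect_diag (r c : nat) (d : nat -> R) : 'M[R]_(r, c) :=
  \matrix_(a, b) if (a : nat) == b then d a.+1 else 0.

End Factors.

(* The nodes x_1, ..., x_{n+1} and t_1, ..., t_{l+1} are given by functions on
   nat, of which only these values are used. *)
Definition lagrange_vandermonde (R : comNzRingType) (l n : nat) (t x : nat -> R) :
    'M[R]_(l.+1, n.+1) :=
  \matrix_(a, b) \prod_(1 <= k < n.+2 | k != b.+1) (t a.+1 - x k).

(* Main.v *)
(* Up to the row scaling w(t_i) = prod_k (t_i - x_k), the matrix A is the Cauchy
   matrix 1 / (t_i - x_j), and so is A^T up to a column scaling and a change of
   sign of the nodes. For a scaled Cauchy matrix every entry on or below row j of
   the j-th Neville iterate is a quotient of two Cauchy determinants, hence a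
   product; the formulas for pivots and multipliers are read off from it.
   Undoing the elimination one diagonal of multipliers at a time gives
   A = F_l ... F_1 U, and the same for A^T; the two LU decompositions agree by
   uniqueness, so U = D G_1 ... G_n. Every square submatrix of A is again a scaled
   Cauchy matrix, so its determinant is the product of its positive pivots. *)
Require Import Defs.
From HB Require Import structures.
From mathcomp Require Import all_boot all_order all_algebra.
From mathcomp Require Import reals.
From mathcomp Require Import ring zify.

Set Implicit Arguments.
Unset Strict Implicit.
Unset Printing Implicit Defensive.

Import Order.TTheory GRing.Theory Num.Theory.
Local Open Scope ring_scope.

(** * Unit lower triangular matrices and uniqueness of LDU *)

Definition unit_lower {R : nzRingType} {N : nat} (L : 'M[R]_N) : Prop :=
  forall a b : 'I_N, (a <= b)%N -> L a b = (a == b)%:R.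

Definition lower_trapezoidal {R : nzRingType} {r c : nat} (B : 'M[R]_(r, c)) :
    Prop :=
  forall (a : 'I_r) (b : 'I_c), (a < b)%N -> B a b = 0.

Lemma unit_lower_mul (R : nzRingType) (N : nat) (L1 L2 : 'M[R]_N) :
  unit_lower L1 -> unit_lower L2 -> unit_lower (L1 *m L2).
Proof.
move=> h1 h2 a b ab; rewrite mxE (bigD1 a) //= h1 // eqxx mul1r h2 //.
rewrite big1 ?addr0 // => k ka; have [lt_ka|le_ak] := ltnP k a.
  rewrite h2; last by lia.
  have -> : (k == b) = false by apply/eqP => kb; rewrite -kb in ab; lia.
  by rewrite mulr0.
by rewrite h1 // eq_sym (negbTE ka) mul0r.
Qed.

Lemma unit_lower_prod (R : nzRingType) (N : nat) (F : nat -> 'M[R]_N.+1)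
    (s : seq nat) :
  (forall i, unit_lower (F i)) -> unit_lower (\prod_(i <- s) F i).
Proof.
move=> hF; elim: s => [|i s IH].
  by move=> a b _; rewrite big_nil mxE.
by rewrite big_cons; apply: unit_lower_mul.
Qed.

Lemma unit_lower_bidiag (R : nzRingType) (N : nat) (m : nat -> nat -> R) i :
  unit_lower (bidiag_factor N m i).
Proof.
move=> a b ab; rewrite mxE; case: eqP => // _.
by have -> : ((a : nat) == b.+1) = false by lia.
Qed.

Lemma unit_lower_det (R : comNzRingType) (N : nat) (L : 'M[R]_N) :
  unit_lower L -> \det L = 1.
Proof.
move=> hL; rewrite det_trig.
  by rewrite big1 // => i _; rewrite hL // eqxx.
apply/is_trig_mxP => i j ij; rewrite hL ?(ltnW ij) //.
by case: eqP => // e; rewrite e ltnn in ij.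
Qed.

(** Forward substitution: in row [a] the terms with [j < a] carry [X j b], which is 0 by induction
    because [j < b], so only the diagonal term survives. *)
Lemma unit_lower_solve (R : nzRingType) (N c : nat) (L : 'M[R]_N)
    (X : 'M[R]_(N, c)) :
  unit_lower L -> lower_trapezoidal (L *m X) ->
  forall (a : 'I_N) (b : 'I_c), (a <= b)%N -> X a b = (L *m X) a b.
Proof.
move=> hL hLX a; have [k ak] := ubnP a; elim: k a ak => // k IH a ak b ab.
rewrite [RHS]mxE (bigD1 a) //= hL // eqxx mul1r big1 ?addr0 // => j ja.
have [lt_ja|le_aj] := ltnP j a; last by rewrite hL // eq_sym (negbTE ja) mul0r.
by rewrite (IH j) ?hLX ?mulr0 //; lia.
Qed.

(* Uniqueness of the LDU decomposition. *)
Lemma ldu_of_two_lu (R : comUnitRingType) (r c : nat) (L : 'M[R]_r)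
    (U : 'M[R]_(r, c)) (L' : 'M[R]_c) (U' : 'M[R]_(c, r)) (d : nat -> R) :
  unit_lower L -> unit_lower L' ->
  lower_trapezoidal U^T -> lower_trapezoidal U'^T ->
  L *m U = (L' *m U')^T ->
  (forall (a : 'I_r) (b : 'I_c), a = b :> nat -> U a b = d a.+1) ->
  U = rect_diag r c d *m L'^T.
Proof.
move=> hL hL' hU hU' e hd.
have uL' : L'^T \in unitmx by rewrite unitmxE det_tr (unit_lower_det hL') unitr1.
(* [X] is diagonal: [L *m X = U'^T] forces zeros above its diagonal and [L' *m X^T = U^T] below; its
   diagonal is that of [U]. *)
pose X := U *m invmx L'^T.
have UX : U = X *m L'^T by rewrite /X mulmxKV.
have LX : L *m X = U'^T.
  by rewrite /X mulmxA e trmx_mul mulmxK.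
have X1 := @unit_lower_solve _ _ _ L X hL.
rewrite LX in X1; have {}X1 := X1 hU'.
have eT : L' *m X^T = U^T by rewrite UX [RHS]trmx_mul trmxK.
have X2 := @unit_lower_solve _ _ _ L' X^T hL'.
rewrite eT in X2; have {}X2 := X2 hU.
suff <- : X = rect_diag r c d by [].
apply/matrixP => a b; rewrite [RHS]mxE.
have [ltab|ltba|eab] := ltngtP a b.
- by rewrite X1 ?(ltnW ltab) // hU'.
- by have := X2 b a (ltnW ltba); rewrite hU // mxE.
- have := X2 b a; rewrite !mxE eab leqnn => /(_ isT) ->.
  by rewrite -eab hd.
Qed.

(** * Undoing Neville elimination by bidiagonal factors *)

Lemma rev_index_iotaS (s : nat) :
  rev (index_iota 1 s.+2) = s.+1 :: rev (index_iota 1 s.+1).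
Proof.
by rewrite /index_iota !subSS !subn0 -[in LHS](addn1 s) iotaD rev_cat add1n.
Qed.

Section NevilleFactorization.
Variables (R : fieldType) (r c : nat) (B : 'M[R]_(r.+1, c.+1)).

Let m i j := if (j <= c.+1)%N then multiplier B i j else 0.

(* Row i of this matrix is row i of B^(min(i - s, c + 2)), and of B if i <= s;
   multiplying by F_(s+1) undoes one elimination step in each row. *)
Definition neville_undo (s : nat) : 'M[R]_(r.+1, c.+1) :=
  \matrix_(a, b) neville_iter B (minn c.+1 (a - s)) a b.

Lemma neville_undoS (s : nat) :
  bidiag_factor r.+1 m s.+1 *m neville_undo s = neville_undo s.+1.
Proof.
apply/matrixP => a b; rewrite !mxE (bigD1 a) //= !mxE eqxx mul1r.
have [les|lts] := leqP a s.
  rewrite big1 ?addr0; first by congr (neville_iter B _ a b); lia.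
  move=> k ka; rewrite !mxE eq_sym (negbTE ka).
  by rewrite (_ : (s.+1 < a.+1)%N = false) ?andbF ?mul0r //; lia.
have pa : (a.-1 < r.+1)%N by have := ltn_ord a; lia.
rewrite (bigD1 (Ordinal pa)) /=; last by rewrite -val_eqE /=; lia.
rewrite big1 ?addr0; last first.
  move=> k /andP[ka kp]; rewrite !mxE eq_sym (negbTE ka).
  suff -> : ((a : nat) == k.+1) = false by rewrite mul0r.
  by apply/eqP => e; move/eqP: kp; apply; apply: val_inj; rewrite /= e.
rewrite !mxE -val_eqE /=.
have -> : ((a : nat) == a.-1) = false by lia.
have -> : ((a : nat) == a.-1.+1) && (s.+1 < a.+1)%N = true by lia.
(* Row [a] stands at iterate [d.+1] and row [a.-1] at iterate [d], both capped at [c.+1]. The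
   factor's entry is the multiplier of step [d.+1], so the product restores row [a] of iterate
   [d]. *)
have [d ad] : exists d, (a - s)%N = d.+1 by exists (a - s).-1; lia.
have -> : (a.-1 - s)%N = d by lia.
have -> : (a.+1 - s.+1)%N = d.+1 by lia.
have -> : (a - s.+1)%N = d by lia.
(* Once the columns are exhausted, the multiplier is 0 by convention and both sides show row [a] of
   the last iterate. *)
rewrite /m ad; have [dc|dc] := leqP d.+1 c.+1; last first.
  have -> : minn c.+1 d = c.+1 by lia.
  by rewrite mul0r addr0; congr (neville_iter B _ a b); lia.
have -> : minn c.+1 d = d by lia.
rewrite /= mxE.
have -> : (a.+1 <= d.+1)%N = false by lia.
rewrite /multiplier /pivot /neville /=.
have -> : neville_iter B d (Ordinal pa) b = ent (neville_iter B d) a b.+1.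
  rewrite /ent /=; congr (neville_iter B d _ _); last by rewrite inord_val.
  by apply: val_inj; rewrite /= inordK.
by rewrite subrK.
Qed.

(** [neville_undo 0] plays the role of U: it holds each row as elimination leaves it for good. After
    [r] factors every row is back at iterate 0, since [a - r = 0] for all row indices. *)
Lemma neville_factorization :
  (\prod_(i <- rev (index_iota 1 r.+1)) bidiag_factor r.+1 m i)
    *m neville_undo 0 = B.
Proof.
have undoE s : (\prod_(i <- rev (index_iota 1 s.+1)) bidiag_factor r.+1 m i)
    *m neville_undo 0 = neville_undo s.
  elim: s => [|s IH].
    by rewrite /index_iota /= big_nil mul1mx.
  by rewrite rev_index_iotaS big_cons -mulmxA IH neville_undoS.
rewrite undoE; apply/matrixP => a b; rewrite mxE.
suff -> : minn c.+1 (a - r) = 0%N by [].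
by have := ltn_ord a; lia.
Qed.

End NevilleFactorization.

(** * Neville elimination of scaled Cauchy matrices *)

Lemma prod_nat_neq0 (R : idomainType) (a b : nat) (F : nat -> R) :
  (forall s, (a <= s < b)%N -> F s != 0) -> \prod_(a <= s < b) F s != 0.
Proof.
move=> hF; rewrite big_nat prodf_seq_neq0; apply/allP => s _.
by apply/implyP => /hF.
Qed.

Lemma entE (R : Type) (r c : nat) (B : 'M[R]_(r.+1, c.+1)) (a : 'I_r.+1)
    (b : 'I_c.+1) : ent B a.+1 b.+1 = B a b.
Proof. by rewrite /ent /= !inord_val. Qed.

Definition scaled_cauchy {R : fieldType} (r c : nat) (al be y z : nat -> R) :
    'M[R]_(r.+1, c.+1) :=
  \matrix_(a, b) (al a.+1 * be b.+1 / (y a.+1 - z b.+1)).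

(* By the Cauchy determinant, the quotient of the minor on rows i-j+1..i and
   columns 1..j-1,k by the minor on rows i-j+1..i-1 and columns 1..j-1. *)
Definition cauchy_elim {R : fieldType} (al be y z : nat -> R) (j i k : nat) : R :=
  al i * be k
  * (\prod_((i - j).+1 <= s < i) (y s - y i))
  * (\prod_(1 <= q < j) (z k - z q))
  / ((\prod_(1 <= q < j) (y i - z q))
     * (\prod_((i - j).+1 <= s < i.+1) (y s - z k))).

Section ScaledCauchy.
Variables (R : fieldType) (r c : nat) (al be y z : nat -> R).
Hypothesis al_neq0 : forall i, (1 <= i <= r.+1)%N -> al i != 0.
Hypothesis be_neq0 : forall k, (1 <= k <= c.+1)%N -> be k != 0.
Hypothesis y_neq : forall s i, (1 <= s < i)%N -> (i <= r.+1)%N -> y s - y i != 0.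
Hypothesis z_neq : forall q k, (1 <= q < k)%N -> (k <= c.+1)%N -> z k - z q != 0.
Hypothesis yz_neq : forall i k, (1 <= i <= r.+1)%N -> (1 <= k <= c.+1)%N ->
  y i - z k != 0.

Let B := scaled_cauchy r c al be y z.
Let E := cauchy_elim al be y z.

(** With [p = i - j], cancelling common factors leaves (y_i - z_j)(y_p - z_k) - (y_p - z_j)(y_i -
    z_k) = (y_p - y_i)(z_k - z_j), whose right side supplies the two numerator factors that
    [E j.+1 i k] has beyond [E j i k]. *)
Lemma cauchy_elim_step j i k :
  (1 <= j <= c.+1)%N -> (j < i <= r.+1)%N -> (1 <= k <= c.+1)%N ->
  E j i k - E j i j / E j i.-1 j * E j i.-1 k = E j.+1 i k.
Proof.
case: i => // i hj hi hk; rewrite /E /cauchy_elim /=.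
have -> : (i - j).+1 = (i.+1 - j)%N by lia.
set p := (i.+1 - j)%N.
have hp : (p < i.+1)%N by rewrite /p; lia.
have hp' : (p <= i.+1)%N by lia.
have p0 : (0 < p)%N by rewrite /p; lia.
have hj1 : (1 <= j)%N by lia.
rewrite !(big_nat_recr _ _ _ hp') /= !(big_nat_recr _ _ _ hj1) /= !(big_ltn hp).
rewrite !(big_nat_recr _ _ _ hp) /=.
field; do ?[apply/andP; split]; do ?[apply: prod_nat_neq0 => s hs];
  first [apply: al_neq0 | apply: be_neq0 | apply: y_neq | apply: z_neq
        | apply: yz_neq]; lia.
Qed.

(** For [i >= j.+1], row [i] of the next iterate draws only on rows [i] and [i.-1], both at or below
    row [j], so the region [j <= i] is closed under the induction. *)
Lemma neville_cauchy j i k :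
  (1 <= j <= c.+2)%N -> (j <= i <= r.+1)%N -> (1 <= k <= c.+1)%N ->
  ent (neville B j) i k = E j i k.
Proof.
case: j => // j; rewrite /neville /=; elim: j i k => [|j IH] i k hj hi hk.
  case: i hi => // i hi; case: k hk => // k hk.
  rewrite /ent mxE !inordK; [|lia..].
  by rewrite /E /cauchy_elim subn1 /= big_nat1 !big_geq // !mulr1 mul1r.
have i0 : (0 < i)%N by lia.
have ri : (i.-1 < r.+1)%N by lia.
rewrite {1}/ent /= mxE inordK // (prednK i0).
have -> : (i <= j.+1)%N = false by lia.
rewrite -cauchy_elim_step; [|lia..].
rewrite -!IH; [|lia..].
have -> : (inord k.-1 : 'I_c.+1).+1 = k by rewrite inordK ?prednK; lia.
by rewrite /ent.
Qed.

Lemma cauchy_elim_neq0 j i :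
  (1 <= j <= c.+1)%N -> (j <= i <= r.+1)%N -> E j i j != 0.
Proof.
move=> hj hi; rewrite /E /cauchy_elim !mulf_neq0 ?invr_neq0 ?mulf_neq0 //.
- by apply: al_neq0; lia.
- exact: be_neq0.
- by apply: prod_nat_neq0 => s hs; apply: y_neq; lia.
- by apply: prod_nat_neq0 => s hs; apply: z_neq; lia.
- by apply: prod_nat_neq0 => s hs; apply: yz_neq; lia.
- by apply: prod_nat_neq0 => s hs; apply: yz_neq; lia.
Qed.

Lemma pivot_cauchy i j :
  (1 <= j <= c.+1)%N -> (j <= i <= r.+1)%N -> pivot B i j = E j i j.
Proof. by move=> hj hi; rewrite /pivot neville_cauchy //; lia. Qed.

Lemma neville_well_defined_cauchy : neville_well_defined B.
Proof.
by move=> i j hj hi; rewrite pivot_cauchy ?cauchy_elim_neq0; lia.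
Qed.

(** Both pivots lie in column [j], so [be j] and the differences [z j - z q] cancel. The row weights
    stay in a separate quotient, ready for substitution. *)
Lemma multiplier_cauchy i j :
  (1 <= j <= c.+1)%N -> (j < i <= r.+1)%N ->
  multiplier B i j =
    al i / al i.-1 * ((y (i - j)%N - z j) / (y i - z j))
    * ((\prod_((i - j).+1 <= s < i) (y s - y i))
       / (\prod_(i - j <= s < i.-1) (y s - y i.-1)))
    * ((\prod_(1 <= q < j) (y i.-1 - z q)) / (\prod_(1 <= q < j) (y i - z q))).
Proof.
move=> hj hi; rewrite /multiplier !pivot_cauchy; [|lia..].
case: i hi => // i hi; rewrite /E /cauchy_elim /=.
have -> : (i - j).+1 = (i.+1 - j)%N by lia.
set p := (i.+1 - j)%N.
have hp : (p < i.+1)%N by rewrite /p; lia.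
have p0 : (0 < p)%N by rewrite /p; lia.
rewrite (big_ltn hp) (big_nat_recr _ _ _ hp) /=.
field; do ?[apply/andP; split]; do ?[apply: prod_nat_neq0 => s hs];
  first [apply: al_neq0 | apply: be_neq0 | apply: y_neq | apply: z_neq
        | apply: yz_neq]; lia.
Qed.

Lemma neville_undo0_cauchy (a : 'I_r.+1) (b : 'I_c.+1) :
  neville_undo B 0 a b = E (minn c.+1 a).+1 a.+1 b.+1.
Proof.
have ha := ltn_ord a; have hb := ltn_ord b.
by rewrite mxE subn0 -entE -neville_cauchy //; lia.
Qed.

(** Below the diagonal the column index [b.+1] lies in the range of [q], so the product of the
    [z b.+1 - z q] contains a zero factor. *)
Lemma neville_undo0_upper : lower_trapezoidal (neville_undo B 0)^T.
Proof.
move=> b a ba; rewrite mxE neville_undo0_cauchy /E /cauchy_elim.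
have hb := ltn_ord b.
have hbm : (b.+1 < (minn c.+1 a).+1)%N by lia.
rewrite (_ : \prod_(1 <= q < _) (z b.+1 - z q) = 0) ?mulr0 ?mul0r //.
rewrite (@big_cat_nat _ _ _ b.+1) //=; last by lia.
by rewrite [X in _ * X]big_ltn // subrr mul0r mulr0.
Qed.

Lemma neville_undo0_diag (a : 'I_r.+1) (b : 'I_c.+1) :
  a = b :> nat -> neville_undo B 0 a b = pivot B a.+1 a.+1.
Proof.
have ha := ltn_ord a; have hb := ltn_ord b.
move=> ab; rewrite neville_undo0_cauchy pivot_cauchy -?ab; [|lia..].
by have -> : minn c.+1 a = a by lia.
Qed.

End ScaledCauchy.

(** * Positive determinants and the LDU factorization *)

Lemma det_scaled_cauchy_gt0 (R : numFieldType) (N : nat) (al be y z : nat -> R) :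
  (forall i, (1 <= i <= N.+1)%N -> 0 < al i) ->
  (forall k, (1 <= k <= N.+1)%N -> 0 < be k) ->
  (forall s i, (1 <= s < i)%N -> (i <= N.+1)%N -> 0 < y s - y i) ->
  (forall q k, (1 <= q < k)%N -> (k <= N.+1)%N -> 0 < z k - z q) ->
  (forall i k, (1 <= i <= N.+1)%N -> (1 <= k <= N.+1)%N -> 0 < y i - z k) ->
  0 < \det (scaled_cauchy N N al be y z).
Proof.
move=> hal hbe hy hz hyz.
have al0 i hi := lt0r_neq0 (hal i hi).
have be0 i hi := lt0r_neq0 (hbe i hi).
have y0 s i hs hi := lt0r_neq0 (hy s i hs hi).
have z0 s i hs hi := lt0r_neq0 (hz s i hs hi).
have yz0 s i hs hi := lt0r_neq0 (hyz s i hs hi).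
rewrite -[scaled_cauchy _ _ _ _ _ _]neville_factorization det_mulmx.
rewrite unit_lower_det ?mul1r; last first.
  by apply: unit_lower_prod => i; apply: unit_lower_bidiag.
rewrite -det_tr det_trig; last first.
  by apply/is_trig_mxP; apply: neville_undo0_upper.
apply: prodr_gt0 => a _; have ha := ltn_ord a.
rewrite mxE neville_undo0_diag // pivot_cauchy ?leqnn //.
rewrite /cauchy_elim divr_gt0 ?mulr_gt0 ?hal ?hbe //;
  rewrite big_nat prodr_gt0 // => s hs;
  first [apply: hy | apply: hz | apply: hyz]; lia.
Qed.

Lemma prod_trmx (R : comNzRingType) (N s : nat) (F : nat -> 'M[R]_N.+1) :
  \prod_(1 <= i < s.+1) (F i)^T = (\prod_(i <- rev (index_iota 1 s.+1)) F i)^T.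
Proof.
elim: s => [|s IH]; first by rewrite /index_iota /= !big_nil trmx1.
by rewrite big_nat_recr //= IH rev_index_iotaS big_cons trmx_mul.
Qed.

Lemma neville_ldu (R : fieldType) (r c : nat) (B : 'M[R]_(r.+1, c.+1)) :
  lower_trapezoidal (neville_undo B 0)^T ->
  lower_trapezoidal (neville_undo B^T 0)^T ->
  (forall (a : 'I_r.+1) (b : 'I_c.+1), a = b :> nat ->
     neville_undo B 0 a b = pivot B a.+1 a.+1) ->
  let m i j := if (j <= c.+1)%N then multiplier B i j else 0 in
  let mt i j := if (j <= r.+1)%N then multiplier B^T i j else 0 in
  B = (\prod_(i <- rev (index_iota 1 r.+1)) bidiag_factor r.+1 m i)
        *m rect_diag r.+1 c.+1 (fun i => pivot B i i)
        *m (\prod_(1 <= i < c.+1) (bidiag_factor c.+1 mt i)^T).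
Proof.
move=> hU hU' hd m mt.
rewrite prod_trmx.
have BE := neville_factorization B; have BTE := neville_factorization B^T.
set L := \prod_(i <- _) bidiag_factor _ m i in BE *.
set L' := \prod_(i <- _) bidiag_factor _ mt i in BTE *.
rewrite -mulmxA -[LHS]BE; congr (_ *m _).
apply: (@ldu_of_two_lu _ _ _ L _ L' _ _ _ _ hU hU') => //.
- by apply: unit_lower_prod => i; apply: unit_lower_bidiag.
- by apply: unit_lower_prod => i; apply: unit_lower_bidiag.
- by rewrite BTE BE trmxK.
Qed.

(** * The Lagrange-Vandermonde matrix *)

Lemma lt_of_lt_succ (R : numDomainType) (N : nat) (x : nat -> R) :
  (forall i, (1 <= i <= N)%N -> x i < x i.+1) ->
  forall q k, (1 <= q < k)%N -> (k <= N.+1)%N -> x q < x k.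
Proof.
move=> hx q; elim=> [|k IH] hq hk; first by lia.
have [->|qk] := eqVneq q k; first by apply: hx; lia.
by apply: lt_trans (IH _ _) (hx _ _); lia.
Qed.

Lemma prod_nat_subC (R : comNzRingType) (a b : nat) (u : R) (v : nat -> R) :
  \prod_(a <= k < b) (u - v k) = (-1) ^+ (b - a) * \prod_(a <= k < b) (v k - u).
Proof.
rewrite -prodr_const_nat -big_split /=.
by apply: eq_bigr => k _; rewrite mulN1r opprB.
Qed.

Lemma lagrange_vandermonde_cauchy (R : fieldType) (l n : nat) (t x : nat -> R) :
  (forall i k, (1 <= i <= l.+1)%N -> (1 <= k <= n.+1)%N -> t i - x k != 0) ->
  lagrange_vandermonde l n t x =
  scaled_cauchy l n (fun i => \prod_(1 <= k < n.+2) (t i - x k)) (fun=> 1) t x.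
Proof.
move=> htx; apply/matrixP => a b; rewrite !mxE mulr1.
rewrite [X in _ = X / _](bigD1_seq b.+1) ?iota_uniq //=; last first.
  by rewrite mem_index_iota; have := ltn_ord b; lia.
by rewrite mulrC mulKf // htx //; have := ltn_ord a; have := ltn_ord b; lia.
Qed.

Theorem theorem1 (R : realType) (n l : nat) (hnl : (n <= l)%N)
    (x t : nat -> R)
    (hx : forall i : nat, (1 <= i <= n)%N -> x i < x i.+1)
    (hxt : x n.+1 < t l.+1)
    (ht : forall i : nat, (1 <= i <= l)%N -> t i.+1 < t i) :
  let A := lagrange_vandermonde l n t x in
  let m := fun i j : nat => if (j <= n.+1)%N then multiplier A i j else 0 in
  let mt := fun i j : nat => multiplier A^T i j in
  let F := fun i : nat => bidiag_factor l.+1 m i in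
  let G := fun i : nat => (bidiag_factor n.+1 mt i)^T in
  let D := rect_diag l.+1 n.+1 (fun i : nat => pivot A i i) in
  strictly_totally_positive A
  /\ neville_well_defined A
  /\ neville_well_defined A^T
  /\ A = (\prod_(i <- rev (index_iota 1 l.+1)) F i) *m D
           *m (\prod_(1 <= i < n.+1) G i)
  /\ (forall i j : nat, (1 <= j <= n.+1)%N -> (j.+1 <= i <= l.+1)%N ->
        multiplier A i j =
          (t (i - j)%N - x j)
          * ((\prod_((i - j).+1 <= k < i) (t i - t k))
               * (\prod_(j.+1 <= k < n.+2) (t i - x k)))
          / ((\prod_(i - j <= k < i.-1) (t i.-1 - t k))
               * (\prod_(j <= k < n.+2) (t i.-1 - x k))))
  /\ (forall i j : nat, (1 <= j <= n)%N -> (j.+1 <= i <= n.+1)%N ->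
        multiplier A^T i j =
          (t j - x (i - j)%N)
          * ((\prod_((i - j).+1 <= k < i) (x i - x k))
               * (\prod_(1 <= k < j) (t k - x i.-1)))
          / ((\prod_(i - j <= k < i.-1) (x i.-1 - x k))
               * (\prod_(1 <= k < j.+1) (t k - x i))))
  /\ (forall i : nat, (1 <= i <= n.+1)%N ->
        pivot A i i =
          (\prod_(1 <= k < i) (t k - t i)) * (\prod_(1 <= k < i) (x i - x k))
            * (\prod_(i.+1 <= k < n.+2) (t i - x k))
          / (\prod_(1 <= k < i) (t k - x i))).
Proof.
move=> A m mt F G D.
have x_lt : forall q k, (1 <= q < k)%N -> (k <= n.+1)%N -> x q < x k.
  exact: lt_of_lt_succ.
have t_lt s i (hs : (1 <= s < i)%N) (hi : (i <= l.+1)%N) : t i < t s.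
  rewrite -ltrN2; apply: (@lt_of_lt_succ _ l (fun i => - t i)) => // j hj.
  by rewrite ltrN2 ht.
have x_le k : (1 <= k <= n.+1)%N -> x k <= x n.+1.
  by move=> hk; have [->//|kn] := eqVneq k n.+1; apply/ltW/x_lt; lia.
have t_le i : (1 <= i <= l.+1)%N -> t l.+1 <= t i.
  by move=> hi; have [->//|kn] := eqVneq i l.+1; apply/ltW/t_lt; lia.
have tx_gt0 i k : (1 <= i <= l.+1)%N -> (1 <= k <= n.+1)%N -> 0 < t i - x k.
  move=> hi hk; rewrite subr_gt0.
  exact: le_lt_trans (x_le _ hk) (lt_le_trans hxt (t_le _ hi)).
pose w i := \prod_(1 <= k < n.+2) (t i - x k).
have w_gt0 i : (1 <= i <= l.+1)%N -> 0 < w i.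
  by move=> hi; rewrite /w big_nat prodr_gt0 // => k hk; apply: tx_gt0; lia.
have AE : A = scaled_cauchy l n w (fun=> 1) t x.
  by apply: lagrange_vandermonde_cauchy => i k hi hk; rewrite lt0r_neq0 ?tx_gt0.
(* Negating the nodes keeps y - z positive and y decreasing. *)
have ATE : A^T = scaled_cauchy n l (fun=> 1) w (fun k => - x k) (fun i => - t i).
  rewrite AE; apply/matrixP => a b; rewrite !mxE mul1r mulr1 opprK.
  by rewrite [- _ + _]addrC.
have w0 i hi := lt0r_neq0 (w_gt0 i hi).
(* Shaped like the hypotheses on [al] and [be], for the constant weight 1. *)
have one0 N k : (1 <= k <= N)%N -> (1 : R) != 0 by rewrite oner_neq0.
have t0 s i (hs : (1 <= s < i)%N) (hi : (i <= l.+1)%N) : t s - t i != 0.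
  by rewrite lt0r_neq0 // subr_gt0 t_lt.
have x0 q k (hq : (1 <= q < k)%N) (hk : (k <= n.+1)%N) : x k - x q != 0.
  by rewrite lt0r_neq0 // subr_gt0 x_lt.
have tx0 i k hi hk := lt0r_neq0 (tx_gt0 i k hi hk).
have t0' s i (hs : (1 <= s < i)%N) (hi : (i <= l.+1)%N) : - t i - - t s != 0.
  by rewrite opprK addrC t0.
have x0' q k (hq : (1 <= q < k)%N) (hk : (k <= n.+1)%N) : - x q - - x k != 0.
  by rewrite opprK addrC x0.
have tx0' k i (hk : (1 <= k <= n.+1)%N) (hi : (1 <= i <= l.+1)%N) :
    - x k - - t i != 0.
  by rewrite opprK addrC tx0.
split.
  case=> [|N] f g hf hg; first by rewrite det_mx00.
  (* [f'] and [g'] are the 1-based index maps. The weight [w] still runs over all [n.+1] nodes, so a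
     minor is in general only a scaled Cauchy determinant, with weights [w \o f']. *)
  pose f' i := (f (inord i.-1)).+1; pose g' k := (g (inord k.-1)).+1.
  have f'b i : (1 <= f' i <= l.+1)%N by rewrite /f' /= ltn_ord.
  have g'b i : (1 <= g' i <= n.+1)%N by rewrite /g' /= ltn_ord.
  have -> : mxsub f g A =
      scaled_cauchy N N (w \o f') (fun=> 1) (t \o f') (x \o g').
    by rewrite AE; apply/matrixP => a b; rewrite !mxE /= /f' /g' /= !inord_val.
  apply: det_scaled_cauchy_gt0 => [i _|k _|s i hs hi|q k hq hk|i k _ _] /=.
  - exact: w_gt0.
  - exact: ltr01.
  - rewrite subr_gt0 t_lt //; last by case/andP: (f'b i).
    by rewrite /f' /= ltnS hf // !inordK; lia.
  - rewrite subr_gt0 x_lt //; last by case/andP: (g'b k).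
    by rewrite /g' /= ltnS hg // !inordK; lia.
  - exact: tx_gt0.
split.
  by rewrite AE; exact: (neville_well_defined_cauchy w0 (one0 n.+1) t0 x0 tx0).
split.
  by rewrite ATE; exact: (neville_well_defined_cauchy (one0 n.+1) w0 x0' t0' tx0').
split.
  have hU : lower_trapezoidal (neville_undo A 0)^T.
    by rewrite AE; exact: (neville_undo0_upper w0 (one0 n.+1) t0 x0 tx0).
  have hU' : lower_trapezoidal (neville_undo A^T 0)^T.
    by rewrite ATE; exact: (neville_undo0_upper (one0 n.+1) w0 x0' t0' tx0').
  rewrite [LHS](neville_ldu hU hU') /=; last first.
    move=> a b ab; rewrite AE.
    exact: (neville_undo0_diag w0 (one0 n.+1) t0 x0 tx0).
  congr (_ *m _ *m _).
  (* [neville_ldu] sets [mt] to 0 beyond column [l.+1]; as [a <= n <= l], that cutoff is never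
     reached. *)
  apply: eq_bigr => i _; congr (_^T); apply/matrixP => a b; rewrite !mxE.
  case: eqP => // _; case: ifP => // /andP[_ ia].
  rewrite ifT //; have := ltn_ord a; lia.
split.
  move=> i j hj hi; rewrite AE (multiplier_cauchy w0 (one0 n.+1) t0 x0 tx0) //.
  (* Cut at [j], the lower part of [w] cancels against the last quotient in [multiplier_cauchy]. *)
  have wE u : w u = \prod_(1 <= k < j) (t u - x k)
      * \prod_(j <= k < n.+2) (t u - x k).
    by rewrite /w (@big_cat_nat _ _ _ j) //=; lia.
  (* Both reversed products have [j.-1] factors, so their signs cancel. *)
  rewrite !wE (prod_nat_subC _ _ (t i) t) (prod_nat_subC _ _ (t i.-1) t).
  have -> : (i - (i - j).+1 = j.-1)%N by lia.
  have -> : (i.-1 - (i - j) = j.-1)%N by lia.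
  have jn : (j < n.+2)%N by lia.
  rewrite (big_ltn jn) /=.
  field; rewrite signr_eq0 /=; do ?[apply/andP; split];
    do ?[apply: prod_nat_neq0 => s hs]; first [apply: t0 | apply: tx0]; lia.
split.
  move=> i j hj hi.
  rewrite ATE (multiplier_cauchy (one0 n.+1) w0 x0' t0' tx0') //; last by lia.
  have subN (u v : R) : - u - - v = v - u by rewrite opprK addrC.
  have prodN a b u (v : nat -> R) :
      \prod_(a <= k < b) (- v k - - u) = \prod_(a <= k < b) (u - v k).
    by apply: eq_bigr => k _; apply: subN.
  have prodN' a b u (v : nat -> R) :
      \prod_(a <= k < b) (- u - - v k) = \prod_(a <= k < b) (v k - u).
    by apply: eq_bigr => k _; apply: subN.
  have j1 : (1 <= j)%N by lia.
  rewrite (big_nat_recr _ _ _ j1) /= divr1 mul1r.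
  rewrite !prodN !prodN' !subN.
  field; do ?[apply/andP; split];
    do ?[apply: prod_nat_neq0 => s hs]; first [apply: x0 | apply: tx0]; lia.
move=> i hi; rewrite AE (pivot_cauchy w0 (one0 n.+1) t0 x0 tx0) //; last by lia.
have i1 : (1 <= i)%N by lia.
have iN : (i < n.+2)%N by lia.
(* In [w i] the factors with [k < i] cancel against the [t i - x q], and the factor [t i - x i]
   against the last [t s - x i]. *)
rewrite /cauchy_elim subnn (big_nat_recr _ _ _ i1) /= /w.
rewrite (@big_cat_nat _ _ _ i 1 n.+2) //=; last by lia.
rewrite (big_ltn iN) /=.
field; do ?[apply/andP; split];
  do ?[apply: prod_nat_neq0 => s hs]; apply: tx0; lia.
Qed.
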